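(* Let $A$ be a $\Bbbk$-algebra over a field $\Bbbk$, let $f:A\otimes_\Bbbk A\to A$ be a Hochschild $2$-cocycle and let $A_f$ be the corresponding infinitesimal deformation. Let $\mathcal C_f$ be the category defined in the context, and let $F:\mathcal C_f\to\operatorname{mod}A_f$ be the functor given on objects by $F(M_0,M_1,T_M,f_M)=M_0\oplus M_1$ as a $\Bbbk$-vector space with $A_f$-action $$(a,b)(m_0,m_1)=(am_0,\;am_1+b\,T_M(m_0)+f_M(a\otimes m_0)),$$ and on morphisms by $F(u_0,u_1,u_2)(m_0,m_1)=(u_0(m_0),\;u_1(m_0)+u_2(m_1))$. Then $F$ is an equivalence of categories.
   Context: Algebras are associative and unital. $\operatorname{mod}R$ denotes the category of finite dimensional left $R$-modules. A Hochschild $2$-cocycle is a $\Bbbk$-linear $f:A\otimes_\Bbbk A\to A$ with $a_0f(a_1\otimes a_2)+f(a_0\otimes a_1a_2)=f(a_0a_1\otimes a_2)+f(a_0\otimes a_1)a_2$. The infinitesimal deformation $A_f$ is $A[t]/(t^2)\simeq A\oplus A$ with product $(a_0,b_0)(a_1,b_1)=(a_0a_1,\;a_0b_1+b_0a_1+f(a_0\otimes a_1))$. The category $\mathcal C_f$: objects are tuples $(M_0,M_1,T_M,f_M)$ with $M_0,M_1\in\operatorname{mod}A$, $T_M\in\operatorname{Hom}_A(M_0,M_1)$ a monomorphism, and $f_M\in\operatorname{Hom}_\Bbbk(A\otimes_\Bbbk M_0,M_1)$ such that $$a f_M(b\otimes m_0)-f_M(ab\otimes m_0)+f_M(a\otimes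 bm_0)-f(a\otimes b)T_M(m_0)=0$$ for all $a,b\in A$, $m_0\in M_0$. Morphisms $(M_0,M_1,T_M,f_M)\to(N_0,N_1,T_N,f_N)$ are triples $(u_0,u_1,u_2)$ with $u_0\in\operatorname{Hom}_A(M_0,N_0)$, $u_1\in\operatorname{Hom}_\Bbbk(M_0,N_1)$, $u_2\in\operatorname{Hom}_A(M_1,N_1)$ such that $T_Nu_0=u_2T_M$ and $$u_1(am_0)=a\,u_1(m_0)-u_2(f_M(a\otimes m_0))+f_N(a\otimes u_0(m_0))$$ for all $a\in A$, $m_0\in M_0$. Composition is $(v_0,v_1,v_2)(u_0,u_1,u_2)=(v_0u_0,\;v_2u_1+v_1u_0,\;v_2u_2)$ and the identity is $(\mathrm{Id},0,\mathrm{Id})$. *)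

(* Defs.v *)
From HB Require Import structures.
From mathcomp Require Import all_boot all_order all_algebra.
From mathcomp Require boolp.

Set Implicit Arguments.
Unset Strict Implicit.
Unset Printing Implicit Defensive.

Import GRing.Theory.
Local Open Scope ring_scope.

(* Hom-sets carry Leibniz equality; morphisms that bundle proofs are compared  *)
(* up to proof irrelevance (boolp.Prop_irrelevance).                           *)
Record category := Category {
  obj :> Type;
  hom : obj -> obj -> Type;
  idc : forall X, hom X X;
  compc : forall X Y Z, hom Y Z -> hom X Y -> hom X Z;
  comp1c : forall X Y (u : hom X Y), compc (idc Y) u = u;
  compc1 : forall X Y (u : hom X Y), compc u (idc X) = u;
  compcA : forall X Y Z W (w : hom Z W) (v : hom Y Z) (u : hom X Y),
    compc w (compc v u) = compc (compc w v) u
}.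
Arguments hom {c} X Y.
Arguments idc {c} X.
Arguments compc {c X Y Z} v u.

Notation "v \oc u" := (compc v u) (at level 50, left associativity).

Definition is_mono (C : category) (X Y : C) (u : hom X Y) : Prop :=
  forall (W : C) (g h : hom W X), u \oc g = u \oc h -> g = h.

Definition is_iso (C : category) (X Y : C) (u : hom X Y) : Prop :=
  exists v : hom Y X, v \oc u = idc X /\ u \oc v = idc Y.

Record functor (C D : category) := Functor {
  fobj :> C -> D;
  fmap : forall X Y, hom X Y -> hom (fobj X) (fobj Y);
  fmap_id : forall X, fmap (idc X) = idc (fobj X);
  fmap_comp : forall X Y Z (v : hom Y Z) (u : hom X Y),
    fmap (v \oc u) = fmap v \oc fmap u
}.
Arguments fmap {C D} f {X Y} u.

Definition id_functor (C : category) : functor C C :=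
  @Functor C C (fun X => X) (fun X Y u => u)
    (fun X => erefl) (fun X Y Z v u => erefl).

Section CompFunctor.
Variables (C D E : category) (G : functor D E) (F : functor C D).

Lemma comp_fmap_id X : fmap G (fmap F (idc X)) = idc (G (F X)).
Proof. by rewrite !fmap_id. Qed.

Lemma comp_fmap_comp X Y Z (v : hom Y Z) (u : hom X Y) :
  fmap G (fmap F (v \oc u)) = fmap G (fmap F v) \oc fmap G (fmap F u).
Proof. by rewrite !fmap_comp. Qed.

Definition comp_functor : functor C E :=
  @Functor C E (fun X => G (F X)) (fun X Y u => fmap G (fmap F u))
    comp_fmap_id comp_fmap_comp.
End CompFunctor.

Definition nat_isomorphic (C D : category) (F G : functor C D) : Prop :=
  exists eta : forall X : C, hom (F X) (G X),
    (forall X Y (u : hom X Y), eta Y \oc fmap F u = fmap G u \oc eta X) /\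
    (forall X, is_iso (eta X)).

Definition is_equivalence (C D : category) (F : functor C D) : Prop :=
  exists G : functor D C,
    nat_isomorphic (comp_functor G F) (id_functor C) /\
    nat_isomorphic (comp_functor F G) (id_functor D).

(* Associative unital k-algebras. The library's algType is not used because it *)
(* also requires 1 != 0, whereas the zero algebra is allowed here. Throughout, *)
(* k-linear maps out of a tensor product of U and V are represented by         *)
(* k-bilinear maps on U and V.                                                 *)
Record algebra (k : fieldType) := Algebra {
  alg_sort :> lmodType k;
  amul : {bilinear alg_sort -> alg_sort -> alg_sort};
  aone : alg_sort;
  amulA : associative amul;
  amul1 : left_id aone amul;
  amulr1 : right_id aone amul
}.
Arguments amul {k} a.
Arguments aone {k} a.

Notation "a ** b" := (amul _ a b) (at level 40, left associativity) : ring_scope.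

Section FdModules.
Variables (k : fieldType) (A : algebra k).

(* Finite dimensional left A-modules: finite dimensional k-vector spaces with  *)
(* a k-bilinear, associative and unital action of A.                           *)
Record fdmod := FdMod {
  fdmod_sort :> vectType k;
  act : {bilinear A -> fdmod_sort -> fdmod_sort};
  act1 : forall m, act (aone A) m = m;
  actM : forall a b m, act (a ** b) m = act a (act b m)
}.

Record modhom (M N : fdmod) := ModHom {
  modhom_fun :> 'Hom(M, N);
  modhomE : forall a m, modhom_fun (act M a m) = act N a (modhom_fun m)
}.

Lemma modhom_inj M N (u v : modhom M N) :
  modhom_fun u = modhom_fun v -> u = v.
Proof.
case: u v => [u uP] [v vP] /= e; rewrite -{v}e in vP *.
by rewrite (boolp.Prop_irrelevance uP vP).
Qed.

Lemma modid_subproof (M : fdmod) a (m : M) :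
  (\1%VF : 'Hom(M, M)) (act M a m) = act M a ((\1%VF : 'Hom(M, M)) m).
Proof. by rewrite !id_lfunE. Qed.

Definition modid (M : fdmod) : modhom M M := ModHom (@modid_subproof M).

Lemma modcomp_subproof M N P (v : modhom N P) (u : modhom M N) a m :
  (v \o u)%VF (act M a m) = act P a ((v \o u)%VF m).
Proof. by rewrite !comp_lfunE !modhomE. Qed.

Definition modcomp M N P (v : modhom N P) (u : modhom M N) : modhom M P :=
  ModHom (modcomp_subproof v u).

Lemma modcomp1m M N (u : modhom M N) : modcomp (modid N) u = u.
Proof. by apply: modhom_inj; rewrite /= comp_lfun1l. Qed.

Lemma modcompm1 M N (u : modhom M N) : modcomp u (modid M) = u.
Proof. by apply: modhom_inj; rewrite /= comp_lfun1r. Qed.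

Lemma modcompA M N P Q (w : modhom P Q) (v : modhom N P) (u : modhom M N) :
  modcomp w (modcomp v u) = modcomp (modcomp w v) u.
Proof. by apply: modhom_inj; rewrite /= comp_lfunA. Qed.

Definition fdmod_cat : category := Category modcomp1m modcompm1 modcompA.

End FdModules.

Arguments act {k A} f.

Section InfinitesimalDeformation.
Variables (k : fieldType) (A : algebra k).

Record cocycle := Cocycle {
  cocycle_fun :> {bilinear A -> A -> A};
  cocycleE : forall a0 a1 a2,
    a0 ** cocycle_fun a1 a2 + cocycle_fun a0 (a1 ** a2) =
    cocycle_fun (a0 ** a1) a2 + cocycle_fun a0 a1 ** a2
}.

Variable f : cocycle.

Definition infdef_mul (x y : (A * A)%type) : (A * A)%type :=
  (x.1 ** y.1, x.1 ** y.2 + x.2 ** y.1 + f x.1 y.1).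

(* Not (1, 0): the cocycle is not assumed to be normalised. *)
Definition infdef_one : (A * A)%type := (aone A, - f (aone A) (aone A)).

Lemma cocycle1l a : f (aone A) a = f (aone A) (aone A) ** a.
Proof. by have := cocycleE f (aone A) (aone A) a; rewrite !amul1 => /addrI. Qed.

Lemma cocycle1r a : f a (aone A) = a ** f (aone A) (aone A).
Proof.
by have := cocycleE f a (aone A) (aone A); rewrite !amulr1 addrC => /addrI ->.
Qed.

Lemma infdef_mulA : associative infdef_mul.
Proof.
move=> [a0 b0] [a1 b1] [a2 b2]; rewrite /infdef_mul /=.
congr pair; first exact: amulA.
rewrite !linearDr !linearDl /= !amulA -!addrA; congr (_ + _); congr (_ + _).
rewrite addrCA; congr (_ + _).
by rewrite cocycleE addrC.
Qed.

Lemma infdef_mul1 : left_id infdef_one infdef_mul.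
Proof.
move=> [a b]; rewrite /infdef_mul /= !amul1 (cocycle1l a) linearNl.
by rewrite addrNK.
Qed.

Lemma infdef_mulr1 : right_id infdef_one infdef_mul.
Proof.
move=> [a b]; rewrite /infdef_mul /= !amulr1 (cocycle1r a) linearNr.
by rewrite addrAC addNr add0r.
Qed.

Lemma infdef_mul_bilinear : bilinear_for *:%R *:%R infdef_mul.
Proof.
split=> [[a1 b1] c [a b] [a' b']|[a b] c [a1 b1] [a' b']].
  congr pair; rewrite /= !linearPl //.
  by rewrite !scalerDr [X in X + _ = _]addrACA [LHS]addrACA.
congr pair; rewrite /= !linearPr //.
by rewrite !scalerDr [X in X + _ = _]addrACA [LHS]addrACA.
Qed.

HB.instance Definition _ := bilinear_isBilinear.Build k
  (A * A)%type (A * A)%type (A * A)%type *:%R *:%R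
  infdef_mul infdef_mul_bilinear.

Definition infdef : algebra k :=
  @Algebra k (A * A)%type infdef_mul infdef_one
    infdef_mulA infdef_mul1 infdef_mulr1.

End InfinitesimalDeformation.

Section CategoryCf.
Variables (k : fieldType) (A : algebra k) (f : cocycle A).

Record cf_obj := CfObj {
  cf0 : fdmod A;
  cf1 : fdmod A;
  cfT : modhom cf0 cf1;
  cff : {bilinear A -> cf0 -> cf1};
  cfT_mono : @is_mono (fdmod_cat A) cf0 cf1 cfT;
  cffE : forall a b m0,
    act cf1 a (cff b m0) - cff (a ** b) m0 + cff a (act cf0 b m0)
      - act cf1 (f a b) (cfT m0) = 0
}.

Record cf_hom (M N : cf_obj) := CfHom {
  cfu0 : modhom (cf0 M) (cf0 N);
  cfu1 : 'Hom(cf0 M, cf1 N);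
  cfu2 : modhom (cf1 M) (cf1 N);
  cf_homT : modcomp (cfT N) cfu0 = modcomp cfu2 (cfT M);
  cf_homE : forall a m0,
    cfu1 (act (cf0 M) a m0) =
    act (cf1 N) a (cfu1 m0) - cfu2 (cff M a m0) + cff N a (cfu0 m0)
}.

Lemma cf_hom_inj M N (u v : cf_hom M N) :
  cfu0 u = cfu0 v -> cfu1 u = cfu1 v -> cfu2 u = cfu2 v -> u = v.
Proof.
case: u v => [u0 u1 u2 uT uE] [v0 v1 v2 vT vE] /= e0 e1 e2.
move: vT vE; rewrite -{}e0 -{}e1 -{}e2 => vT vE.
by rewrite (boolp.Prop_irrelevance uT vT) (boolp.Prop_irrelevance uE vE).
Qed.

Lemma cf_id_subproofT (M : cf_obj) :
  modcomp (cfT M) (modid (cf0 M)) = modcomp (modid (cf1 M)) (cfT M).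
Proof. by rewrite modcompm1 modcomp1m. Qed.

Lemma cf_id_subproofE (M : cf_obj) a m0 :
  (0 : 'Hom(cf0 M, cf1 M)) (act (cf0 M) a m0) =
  act (cf1 M) a ((0 : 'Hom(cf0 M, cf1 M)) m0)
    - modid (cf1 M) (cff M a m0) + cff M a (modid (cf0 M) m0).
Proof. by rewrite /= !lfunE /= linear0r sub0r addNr. Qed.

Definition cf_id (M : cf_obj) : cf_hom M M :=
  CfHom (cf_id_subproofT M) (@cf_id_subproofE M).

Section Comp.
Variables (M N P : cf_obj) (v : cf_hom N P) (u : cf_hom M N).

Definition cf_comp0 := modcomp (cfu0 v) (cfu0 u).
Definition cf_comp1 : 'Hom(cf0 M, cf1 P) :=
  (cfu2 v \o cfu1 u)%VF + (cfu1 v \o cfu0 u)%VF.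
Definition cf_comp2 := modcomp (cfu2 v) (cfu2 u).

Lemma cf_comp_subproofT : modcomp (cfT P) cf_comp0 = modcomp cf_comp2 (cfT M).
Proof.
by rewrite /cf_comp0 /cf_comp2 modcompA cf_homT -!modcompA cf_homT.
Qed.

Lemma cf_comp_subproofE a m0 :
  cf_comp1 (act (cf0 M) a m0) =
  act (cf1 P) a (cf_comp1 m0) - cf_comp2 (cff M a m0) + cff P a (cf_comp0 m0).
Proof.
rewrite /cf_comp1 /= !add_lfunE !comp_lfunE !modhomE !cf_homE.
rewrite linearD linearB /= linearDr !modhomE.
rewrite !addrA; congr (_ + _).
by rewrite [LHS]addrAC addrK addrAC.
Qed.

Definition cf_comp : cf_hom M P := CfHom cf_comp_subproofT cf_comp_subproofE.
End Comp.

Lemma cf_comp1m M N (u : cf_hom M N) : cf_comp (cf_id N) u = u.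
Proof.
apply: cf_hom_inj => /=; [exact: modcomp1m | | exact: modcomp1m].
by rewrite /cf_comp1 /= comp_lfun1l comp_lfun0l addr0.
Qed.

Lemma cf_compm1 M N (u : cf_hom M N) : cf_comp u (cf_id M) = u.
Proof.
apply: cf_hom_inj => /=; [exact: modcompm1 | | exact: modcompm1].
by rewrite /cf_comp1 /= comp_lfun1r comp_lfun0r add0r.
Qed.

Lemma cf_compA M N P Q (w : cf_hom P Q) (v : cf_hom N P) (u : cf_hom M N) :
  cf_comp w (cf_comp v u) = cf_comp (cf_comp w v) u.
Proof.
apply: cf_hom_inj => /=; [exact: modcompA | | exact: modcompA].
by rewrite /cf_comp1 /= comp_lfunDr comp_lfunDl !comp_lfunA addrA.
Qed.

Definition cf_cat : category := Category cf_comp1m cf_compm1 cf_compA.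

Section FunctorObj.
Variable M : cf_obj.

Definition F_act (x : infdef f) (m : (cf0 M * cf1 M)%type) :
    (cf0 M * cf1 M)%type :=
  (act (cf0 M) x.1 m.1,
   act (cf1 M) x.1 m.2 + act (cf1 M) x.2 (cfT M m.1) + cff M x.1 m.1).

Lemma F_act_bilinear : bilinear_for *:%R *:%R F_act.
Proof.
split=> [[m0 m1] c [a b] [a' b']|[a b] c [m0 m1] [n0 n1]].
  congr pair; rewrite /= !linearPl //.
  by rewrite !scalerDr [X in X + _ = _]addrACA [LHS]addrACA.
congr pair; first exact: linearPr.
rewrite /= (linearP (modhom_fun (cfT M))) !linearPr.
by rewrite !scalerDr [X in X + _ = _]addrACA [LHS]addrACA.
Qed.

HB.instance Definition _ := bilinear_isBilinear.Build k (infdef f)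
  (cf0 M * cf1 M)%type (cf0 M * cf1 M)%type *:%R *:%R F_act F_act_bilinear.

Lemma cff1 m0 : cff M (aone A) m0 = act (cf1 M) (f (aone A) (aone A)) (cfT M m0).
Proof.
have := cffE (aone A) (aone A) m0; rewrite amulr1 !act1 subrr add0r.
by move/eqP; rewrite subr_eq0 => /eqP.
Qed.

Lemma F_act1 m : F_act (aone (infdef f)) m = m.
Proof.
case: m => m0 m1; rewrite /F_act /= !act1 cff1 linearNl.
by rewrite addrNK.
Qed.

Lemma F_actM (x y : infdef f) m : F_act (x ** y) m = F_act x (F_act y m).
Proof.
case: x y m => [a b] [a' b'] [m0 m1]; rewrite /F_act /= !actM.
congr pair.
rewrite !linearDl !linearDr /= !actM !modhomE -!addrA.
congr (_ + _); congr (_ + _).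
rewrite [RHS]addrCA; congr (_ + _).
have /eqP := cffE a a' m0; rewrite subr_eq0 => /eqP <-.
by rewrite addrAC addrNK.
Qed.

Definition F_obj : fdmod (infdef f) :=
  @FdMod k (infdef f) (cf0 M * cf1 M)%type F_act F_act1 F_actM.
End FunctorObj.

Section FunctorHom.
Variables (M N : cf_obj) (u : cf_hom M N).

Definition F_hom_fun (m : (cf0 M * cf1 M)%type) : (cf0 N * cf1 N)%type :=
  (cfu0 u m.1, cfu1 u m.1 + cfu2 u m.2).

Lemma F_hom_fun_linear : linear F_hom_fun.
Proof.
move=> c [m0 m1] [n0 n1]; congr pair; rewrite /= !linearP //.
by rewrite scalerDr addrACA.
Qed.

HB.instance Definition _ := GRing.isLinear.Build k
  (cf0 M * cf1 M)%type (cf0 N * cf1 N)%type *:%R F_hom_fun F_hom_fun_linear.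

Lemma F_hom_subproof x m :
  (linfun F_hom_fun : 'Hom(F_obj M, F_obj N)) (act (F_obj M) x m) =
  act (F_obj N) x ((linfun F_hom_fun : 'Hom(F_obj M, F_obj N)) m).
Proof.
rewrite !lfunE; case: x m => [a b] [m0 m1]; congr pair; rewrite /=.
  by rewrite modhomE.
have Tu : cfT N (cfu0 u m0) = cfu2 u (cfT M m0).
  have /(congr1 (fun h => modhom_fun h m0)) := cf_homT u.
  by rewrite /= !comp_lfunE.
rewrite cf_homE !linearD /= !modhomE Tu [LHS]addrAC; congr (_ + _).
by rewrite [LHS]addrAC [X in X - _ = _]addrA addrK addrA.
Qed.

Definition F_hom : modhom (F_obj M) (F_obj N) := ModHom F_hom_subproof.
End FunctorHom.

Lemma F_hom_id M : F_hom (cf_id M) = modid (F_obj M).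
Proof.
apply: modhom_inj; apply/lfunP => -[m0 m1]; rewrite /= !lfunE /=.
by rewrite /F_hom_fun /= !lfunE /= add0r.
Qed.

Lemma F_hom_comp M N P (v : cf_hom N P) (u : cf_hom M N) :
  F_hom (cf_comp v u) = modcomp (F_hom v) (F_hom u).
Proof.
apply: modhom_inj; apply/lfunP => -[m0 m1]; rewrite /= comp_lfunE !lfunE /=.
rewrite /F_hom_fun /= /cf_comp1 !add_lfunE !comp_lfunE linearD /=.
by congr pair; rewrite -addrA addrCA.
Qed.

Definition cf_functor : functor cf_cat (fdmod_cat (infdef f)) :=
  @Functor cf_cat (fdmod_cat (infdef f)) F_obj F_hom F_hom_id F_hom_comp.

End CategoryCf.

(* Main.v *)
(* Multiplication by t = (0, 1) on F(M) is (m0, m1) |-> (0, T m0), and T is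
   injective, so M1 is the kernel of t. Module maps commute with t, hence
   preserve these kernels and are triangular, which makes F fully faithful.
   Conversely, for an A_f-module X let M1 be the kernel of t, M0 its image, T
   the inclusion, s a linear section of t : X -> M0, and set
   f_M(a, m) = (a, 0) s(m) - s(a m); then (m0, m1) |-> s(m0) + m1 is an
   isomorphism from F(M) to X. *)
Require Import Defs.
From HB Require Import structures.
From mathcomp Require Import all_boot all_order all_algebra.
From mathcomp Require boolp.

Set Implicit Arguments.
Unset Strict Implicit.
Unset Printing Implicit Defensive.

Import GRing.Theory.
Local Open Scope ring_scope.

(** * Fully faithful, essentially surjective functors are equivalences *)

Section FullyFaithful.
Variables (C D : category) (F : functor C D).
Hypothesis F_faithful : forall (X Y : C) (u v : Defs.hom X Y),
  fmap F u = fmap F v -> u = v.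
Hypothesis F_full : forall (X Y : C) (v : Defs.hom (F X) (F Y)),
  exists u : Defs.hom X Y, fmap F u = v.
Hypothesis F_ess_surj : forall Y : D,
  exists X (e : Defs.hom (F X) Y), is_iso e.

(** By choice, every Y gets an object [g Y] with an isomorphism [e Y] from F (g Y) to Y. The
    quasi-inverse sends u to the lift along F of u conjugated by [e]; faithfulness turns every
    identity required in C into one in D. *)
Lemma fully_faithful_ess_surj_equivalence : is_equivalence F.
Proof.
have pre (Y : D) : {X : C & {e : Defs.hom (F X) Y & {e' : Defs.hom Y (F X) |
    e' \oc e = idc _ /\ e \oc e' = idc _}}}.
  have [X /boolp.cid[e /boolp.cid[e' eP]]] := boolp.cid (F_ess_surj Y).
  by exists X, e, e'.
pose g Y := projT1 (pre Y).
pose e Y : Defs.hom (F (g Y)) Y := projT1 (projT2 (pre Y)).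
pose e' Y : Defs.hom Y (F (g Y)) := proj1_sig (projT2 (projT2 (pre Y))).
have e'e Y : e' Y \oc e Y = idc _ by case: (proj2_sig (projT2 (projT2 (pre Y)))).
have ee' Y : e Y \oc e' Y = idc _ by case: (proj2_sig (projT2 (projT2 (pre Y)))).
pose lift X Y (v : Defs.hom (F X) (F Y)) := proj1_sig (boolp.cid (F_full v)).
have liftK X Y (v : Defs.hom (F X) (F Y)) : fmap F (lift X Y v) = v.
  by rewrite /lift; case: boolp.cid.
pose gmap X Y (u : Defs.hom X Y) := lift _ _ (e' Y \oc (u \oc e X)).
have gmap_id X : gmap X X (idc X) = idc _.
  by apply: F_faithful; rewrite liftK fmap_id comp1c e'e.
have gmap_comp X Y Z (v : Defs.hom Y Z) (u : Defs.hom X Y) :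
    gmap X Z (v \oc u) = gmap _ _ v \oc gmap _ _ u.
  apply: F_faithful; rewrite fmap_comp !liftK !compcA.
  by rewrite -(compcA _ (e Y)) ee' compc1.
exists (@Functor D C g gmap gmap_id gmap_comp); split.
(* The isomorphism [e (F X)] goes from F (g (F X)) to F X, so fullness lifts it, and its inverse, to
   C. *)
- exists (fun X => lift _ _ (e (F X))); split=> [X Y u | X] /=.
    apply: F_faithful; rewrite !fmap_comp !liftK.
    by rewrite compcA ee' comp1c.
  exists (lift _ _ (e' (F X))).
  by split; apply: F_faithful; rewrite fmap_comp !liftK fmap_id.
- exists (fun Y => e Y); split=> [X Y u | Y] /=.
    by rewrite liftK compcA ee' comp1c.
  by exists (e' Y).
Qed.

End FullyFaithful.

(** * Modules carried by stable subspaces *)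

Section SubModule.
Variables (k : fieldType) (A : algebra k) (V : vectType k).
Variables (B : {bilinear A -> V -> V}) (U : {vspace V}).

(** Projecting onto U keeps the map total and bilinear before stability is known. The module axioms
    are asked of B on U only, because below B is m |-> (a, 0) m, which obeys them on the kernel of t
    but not in general. *)
Definition sub_act (a : A) (m : subvs_of U) : subvs_of U :=
  vsproj U (B a (vsval m)).

Lemma sub_act_bilinear : bilinear_for *:%R *:%R sub_act.
Proof.
by split=> [m c a b | a c m n]; rewrite /sub_act !(linearPl, linearPr, linearP).
Qed.

HB.instance Definition _ := bilinear_isBilinear.Build k A
  (subvs_of U) (subvs_of U) *:%R *:%R sub_act sub_act_bilinear.

Hypothesis U_stable : forall a m, m \in U -> B a m \in U.
Hypothesis U_unital : forall m, m \in U -> B (aone A) m = m.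
Hypothesis U_assoc : forall a b m, m \in U -> B (a ** b) m = B a (B b m).

Lemma val_sub_act a m : vsval (sub_act a m) = B a (vsval m).
Proof. by rewrite vsprojK ?U_stable ?subvsP. Qed.

Lemma sub_act1 m : sub_act (aone A) m = m.
Proof. by apply: subvs_inj; rewrite val_sub_act U_unital ?subvsP. Qed.

Lemma sub_actM a b m : sub_act (a ** b) m = sub_act a (sub_act b m).
Proof. by apply: subvs_inj; rewrite !val_sub_act U_assoc ?subvsP. Qed.

Definition sub_fdmod : fdmod A := @FdMod k A (subvs_of U) sub_act sub_act1 sub_actM.

End SubModule.

(** * Monomorphisms and isomorphisms of modules *)

Section ModuleMorphisms.
Variables (k : fieldType) (A : algebra k) (M N : fdmod A).

(** The kernel of u is a submodule; its inclusion and the zero map have the same composite with u,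
    so they coincide. *)
Lemma modhom_mono_inj (u : modhom M N) :
  @is_mono (fdmod_cat A) M N u -> injective u.
Proof.
move=> u_mono; apply/lker0P.
have K_stable a m : m \in lker u -> act M a m \in lker u.
  by rewrite !memv_ker modhomE => /eqP ->; rewrite linear0r.
pose K := sub_fdmod K_stable (fun m _ => act1 m) (fun a b m _ => actM a b m).
have iP a (m : K) : (linfun vsval : 'Hom(K, M)) (act K a m) =
    act M a ((linfun vsval : 'Hom(K, M)) m).
  by rewrite !lfunE /= (val_sub_act K_stable).
have zP a (m : K) : (0 : 'Hom(K, M)) (act K a m) = act M a ((0 : 'Hom(K, M)) m).
  by rewrite !lfunE /= linear0r.
have eq_iz : ModHom iP = ModHom zP.
  apply: u_mono; apply: modhom_inj; apply/lfunP => m /=.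
  rewrite !comp_lfunE !lfunE /= linear0.
  by apply/eqP; rewrite -memv_ker subvsP.
rewrite -subv0; apply/subvP => m mK.
have := congr1 (fun h : modhom K M => h (vsproj (lker u) m)) eq_iz.
by rewrite /= !lfunE /= vsprojK // => ->; rewrite mem0v.
Qed.

(** The map v is a bare function; linearity comes from the pseudo-inverse of u, which agrees with v
    because u is bijective. *)
Lemma bij_modhom_iso (u : modhom M N) (v : N -> M) :
  cancel u v -> cancel v u -> @is_iso (fdmod_cat A) M N u.
Proof.
move=> uK vK.
have ker_u : lker u == 0%VS by apply/lker0P/(can_inj uK).
have wE n : ((u : 'Hom(M, N))^-1)%VF n = v n by rewrite -{1}(vK n) lker0_lfunK.
have wP a n : ((u : 'Hom(M, N))^-1)%VF (act N a n) =
    act M a (((u : 'Hom(M, N))^-1)%VF n).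
  by rewrite !wE -{1}(vK n) -modhomE uK.
exists (ModHom wP); split; apply: modhom_inj; apply/lfunP => x /=.
  by rewrite comp_lfunE id_lfunE wE uK.
by rewrite comp_lfunE id_lfunE wE vK.
Qed.

End ModuleMorphisms.

(** * Injectivity of T and faithfulness of F *)

Section Equivalence.
Variables (k : fieldType) (A : algebra k) (f : cocycle A).

Lemma cfT_inj (M : cf_obj f) : injective (cfT M).
Proof. exact: modhom_mono_inj (@cfT_mono _ _ _ M). Qed.

Lemma F_homE (M N : cf_obj f) (u : cf_hom M N) m0 m1 :
  F_hom u (m0, m1) = (cfu0 u m0, cfu1 u m0 + cfu2 u m1).
Proof. by rewrite /= lfunE. Qed.

(** The values at (m, 0) and (0, m) determine all three components. *)
Lemma F_hom_faithful (M N : cf_obj f) (u v : cf_hom M N) :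
  F_hom u = F_hom v -> u = v.
Proof.
move=> e; have E m0 m1 := congr1 (fun h : modhom (F_obj M) (F_obj N) => h (m0, m1)) e.
have {e}E m0 m1 : (cfu0 u m0, cfu1 u m0 + cfu2 u m1) =
    (cfu0 v m0, cfu1 v m0 + cfu2 v m1) by rewrite -!F_homE.
apply: cf_hom_inj; first 1 last.
- by apply/lfunP=> m; case: (E m 0) => _; rewrite !linear0 !addr0.
- by apply/modhom_inj/lfunP=> m; case: (E 0 m) => _; rewrite !linear0 !add0r.
- by apply/modhom_inj/lfunP=> m; case: (E m 0).
Qed.

Lemma F_actE (M : cf_obj f) (a b : A) m0 m1 :
  act (F_obj M) (a, b) (m0, m1) =
  (act (cf0 M) a m0,
   act (cf1 M) a m1 + act (cf1 M) b (cfT M m0) + cff M a m0).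
Proof. by []. Qed.

(** * Fullness of F *)

Section Full.
Variables (M N : cf_obj f) (v : modhom (F_obj M) (F_obj N)).

(** Matrix blocks of v: the first index is the target summand, the second the source summand. *)
Definition blk00 (m : cf0 M) : cf0 N := (v (m, 0)).1.
Definition blk10 (m : cf0 M) : cf1 N := (v (m, 0)).2.
Definition blk11 (m : cf1 M) : cf1 N := (v (0, m)).2.

Lemma pair0l_linear c (m n : cf0 M) :
  (c *: m + n, 0) = c *: (m, 0) + (n, 0) :> F_obj M.
Proof. by congr pair; rewrite /= scaler0 addr0. Qed.

Lemma pair0r_linear c (m n : cf1 M) :
  (0, c *: m + n) = c *: (0, m) + (0, n) :> F_obj M.
Proof. by congr pair; rewrite /= scaler0 addr0. Qed.

Lemma blk00_linear : linear blk00.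
Proof. by move=> c m n; rewrite /blk00 pair0l_linear linearP. Qed.
Lemma blk10_linear : linear blk10.
Proof. by move=> c m n; rewrite /blk10 pair0l_linear linearP. Qed.
Lemma blk11_linear : linear blk11.
Proof. by move=> c m n; rewrite /blk11 pair0r_linear linearP. Qed.

HB.instance Definition _ :=
  GRing.isLinear.Build k (cf0 M) (cf0 N) *:%R blk00 blk00_linear.
HB.instance Definition _ :=
  GRing.isLinear.Build k (cf0 M) (cf1 N) *:%R blk10 blk10_linear.
HB.instance Definition _ :=
  GRing.isLinear.Build k (cf1 M) (cf1 N) *:%R blk11 blk11_linear.

(** As t = (0, 1) kills (0, m), it kills v (0, m) = (n0, n1); but t (n0, n1) = (0, T n0) and T is
    injective. *)
Lemma blk01 m : (v (0, m)).1 = 0.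
Proof.
apply: (@cfT_inj N); rewrite linear0.
have := modhomE v (0, aone A) (0, m).
rewrite F_actE !(linear0, linear0l, linear0r) !addr0 linear0.
case: (v (0, m)) => n0 n1; rewrite F_actE !linear0l act1 add0r addr0.
by case.
Qed.

Lemma blkE m0 m1 : v (m0, m1) = (blk00 m0, blk10 m0 + blk11 m1).
Proof.
have -> : (m0, m1) = (m0, 0) + (0, m1) :> F_obj M.
  by congr pair; rewrite /= ?addr0 ?add0r.
rewrite linearD /blk00 /blk10 /blk11.
by apply: injective_projections; rewrite //= blk01 addr0.
Qed.

(** All conditions on a morphism of C_f are specialisations of this: b = 0 gives the linearity of
    the diagonal blocks and the condition on u1, while a = 0, b = 1 gives compatibility with T. *)
Lemma blk_act a b m0 m1 :
  blk00 (act (cf0 M) a m0) = act (cf0 N) a (blk00 m0) /\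
  blk10 (act (cf0 M) a m0) +
    blk11 (act (cf1 M) a m1 + act (cf1 M) b (cfT M m0) + cff M a m0) =
  act (cf1 N) a (blk10 m0 + blk11 m1) + act (cf1 N) b (cfT N (blk00 m0))
    + cff N a (blk00 m0).
Proof.
by have := modhomE v (a, b) (m0, m1); rewrite F_actE !blkE F_actE => -[].
Qed.

Lemma blk00_hom a m : (linfun blk00) (act (cf0 M) a m) = act (cf0 N) a (linfun blk00 m).
Proof. by rewrite !lfunE; case: (blk_act a 0 m 0). Qed.

Lemma blk11_hom a m : (linfun blk11) (act (cf1 M) a m) = act (cf1 N) a (linfun blk11 m).
Proof.
rewrite !lfunE; case: (blk_act a 0 0 m) => _.
by rewrite !(linear0, linear0l, linear0r) !addr0 !add0r.
Qed.

Lemma blk_homT :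
  modcomp (cfT N) (ModHom blk00_hom) = modcomp (ModHom blk11_hom) (cfT M).
Proof.
apply: modhom_inj; apply/lfunP => m; rewrite /= !comp_lfunE !lfunE /=.
case: (blk_act 0 (aone A) m 0) => _.
by rewrite !(linear0, linear0l, linear0r) !act1 !add0r !addr0 => ->.
Qed.

Lemma blk_homE a m :
  linfun blk10 (act (cf0 M) a m) = act (cf1 N) a (linfun blk10 m)
   - ModHom blk11_hom (cff M a m) + cff N a (ModHom blk00_hom m).
Proof.
rewrite /= !lfunE /=; case: (blk_act a 0 m 0) => _.
rewrite !(linear0, linear0l, linear0r) !addr0 add0r => /(canRL (addrK _)) ->.
by rewrite addrAC.
Qed.

Lemma F_hom_full : exists u, F_hom u = v.
Proof.
exists (CfHom blk_homT blk_homE); apply: modhom_inj; apply/lfunP => -[m0 m1].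
by rewrite F_homE blkE /= !lfunE.
Qed.

End Full.

(** * Essential surjectivity of F *)

Section EssSurj.
Variable X : fdmod (infdef f).

Definition base_act (a : A) (m : X) : X := act X ((a, 0) : infdef f) m.

Lemma base_act_bilinear : bilinear_for *:%R *:%R base_act.
Proof.
split=> [m c a b | a c m n]; rewrite /base_act ?linearPr //.
have -> : (c *: a + b, 0) = c *: (a, 0) + (b, 0) :> infdef f.
  by congr pair; rewrite /= scaler0 addr0.
by rewrite linearPl.
Qed.

HB.instance Definition _ := bilinear_isBilinear.Build k A X X
  *:%R *:%R base_act base_act_bilinear.

Lemma base_actD a m n : base_act a (m + n) = base_act a m + base_act a n.
Proof. exact: linearDr. Qed.

Lemma base_actB a m n : base_act a (m - n) = base_act a m - base_act a n.
Proof. exact: linearBr. Qed.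

Definition t_act : 'End(X) := linfun (act X ((0, aone A) : infdef f)).

Lemma t_actE m : t_act m = act X ((0, aone A) : infdef f) m.
Proof. by rewrite lfunE. Qed.

(** In A_f, (a, b) = (a, 0) + (b, 0) (0, 1). *)
Lemma act_base (a b : A) m :
  act X ((a, b) : infdef f) m = base_act a m + base_act b (t_act m).
Proof.
rewrite t_actE /base_act -actM -linearDl /=; congr (act X _ m).
rewrite /infdef_mul /= !(linear0l, linear0r) amulr1 !addr0.
by congr pair; rewrite /= ?addr0 ?add0r.
Qed.

Lemma t_base a m : t_act (base_act a m) = base_act a (t_act m).
Proof.
rewrite !t_actE /base_act -!actM; congr (act X _ m).
by rewrite /= /infdef_mul /= !(linear0l, linear0r) amul1 amulr1 !addr0 !add0r.
Qed.

Lemma t_t m : t_act (t_act m) = 0.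
Proof.
rewrite !t_actE -actM; have -> : ((0, aone A) : infdef f) ** ((0, aone A) : infdef f) = 0.
  by rewrite /= /infdef_mul /= !(linear0l, linear0r) !addr0.
exact: linear0l.
Qed.

(** In A_f, (a, 0) (b, 0) = (ab, f(a, b)). The failure of associativity factors through t, hence
    vanishes on its kernel. *)
Lemma base_actM a b m :
  base_act a (base_act b m) = base_act (a ** b) m + base_act (f a b) (t_act m).
Proof.
rewrite -act_base /base_act -actM; congr (act X _ m).
by rewrite /= /infdef_mul /= !(linear0l, linear0r) !add0r.
Qed.

(** The unit of A_f is (1, - f(1, 1)), and its second component acts through t. *)
Lemma ker_unital m : m \in lker t_act -> base_act (aone A) m = m.
Proof.
rewrite memv_ker => /eqP tm0; have := act1 m.
by rewrite /= act_base tm0 linear0r addr0.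
Qed.

Lemma ker_assoc a b m :
  m \in lker t_act -> base_act (a ** b) m = base_act a (base_act b m).
Proof. by rewrite memv_ker base_actM => /eqP ->; rewrite linear0r addr0. Qed.

Lemma ker_stable a m : m \in lker t_act -> base_act a m \in lker t_act.
Proof. by rewrite !memv_ker t_base => /eqP ->; rewrite linear0r. Qed.

Lemma img_sub_ker m : m \in limg t_act -> m \in lker t_act.
Proof. by case/memv_imgP => x _ ->; rewrite memv_ker t_t. Qed.

Lemma img_stable a m : m \in limg t_act -> base_act a m \in limg t_act.
Proof. by case/memv_imgP => x _ ->; rewrite -t_base memv_img ?memvf. Qed.

Definition ker_mod : fdmod A := sub_fdmod ker_stable ker_unital ker_assoc.
Definition img_mod : fdmod A :=
  sub_fdmod img_stable (fun m h => ker_unital (img_sub_ker h))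
    (fun a b m h => ker_assoc a b (img_sub_ker h)).

Lemma val_ker_act a (m : ker_mod) : vsval (act ker_mod a m) = base_act a (vsval m).
Proof. exact: (val_sub_act ker_stable). Qed.

Lemma val_img_act a (m : img_mod) : vsval (act img_mod a m) = base_act a (vsval m).
Proof. exact: (val_sub_act img_stable). Qed.

Definition img_incl : 'Hom(img_mod, ker_mod) :=
  linfun (vsproj (lker t_act) \o vsval : img_mod -> ker_mod).

Lemma val_img_incl m : vsval (img_incl m) = vsval m.
Proof. by rewrite lfunE /= vsprojK // img_sub_ker ?subvsP. Qed.

Lemma img_incl_hom a m : img_incl (act img_mod a m) = act ker_mod a (img_incl m).
Proof.
by apply: subvs_inj; rewrite val_img_incl val_ker_act val_img_act val_img_incl.
Qed.

Lemma img_incl_mono : @is_mono (fdmod_cat A) img_mod ker_mod (ModHom img_incl_hom).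
Proof.
move=> W g h e; apply: modhom_inj; apply/lfunP => w; apply: subvs_inj.
have := congr1 (fun u : modhom W ker_mod => vsval (u w)) e.
by rewrite /= !comp_lfunE !val_img_incl.
Qed.

(** The pseudo-inverse of a linear map is a right inverse on its image, which provides the section
    s. *)
Definition t_sec (m : img_mod) : X := (t_act^-1)%VF (vsval m).

Lemma t_sec_linear : linear t_sec.
Proof. by move=> c m n; rewrite /t_sec !linearP. Qed.

HB.instance Definition _ := GRing.isLinear.Build k img_mod X *:%R t_sec t_sec_linear.

Lemma t_secK m : t_act (t_sec m) = vsval m.
Proof. by rewrite /t_sec limg_lfunVK ?subvsP. Qed.

Definition sec_defect (a : A) (m : img_mod) : ker_mod :=
  vsproj (lker t_act) (base_act a (t_sec m) - t_sec (act img_mod a m)).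

Lemma sec_defect_bilinear : bilinear_for *:%R *:%R sec_defect.
Proof.
split=> [m c a b | a c m n]; rewrite /sec_defect -linearP; congr (vsproj _ _).
  by rewrite !linearPl linearP scalerBr opprD addrACA.
by rewrite linearPr linearP linearPr linearP scalerBr opprD addrACA.
Qed.

HB.instance Definition _ := bilinear_isBilinear.Build k A img_mod ker_mod
  *:%R *:%R sec_defect sec_defect_bilinear.

(** The projection in [sec_defect] changes nothing: t commutes with (a, 0) and t s is the identity,
    so t kills the difference. *)
Lemma val_sec_defect a m :
  vsval (sec_defect a m) = base_act a (t_sec m) - t_sec (act img_mod a m).
Proof.
by rewrite vsprojK // memv_ker linearB /= t_base !t_secK val_img_act subrr.
Qed.

(** The terms in s(bm) and s(abm) cancel, leaving a(b s(m)) - (ab) s(m) - f(a, b) m, which is zero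
    by [base_actM] and t s(m) = m. *)
Lemma sec_defectE a b m :
  act ker_mod a (sec_defect b m) - sec_defect (a ** b) m
    + sec_defect a (act img_mod b m) - act ker_mod (f a b) (img_incl m) = 0.
Proof.
apply: subvs_inj; rewrite !(linearB, linearD) /= !val_ker_act !val_sec_defect.
rewrite val_img_incl actM base_actB base_actM t_secK opprB.
(* Refolds the action exposed by simplification, so that equal terms match. *)
rewrite -[sub_act _ b m]/(act img_mod b m).
set P := base_act (a ** b) _; set S := t_sec (act _ a _).
rewrite -(addrA _ (S - P)) [S - P + _]addrC !subrKA.
by rewrite [P + _]addrC addrK subrr.
Qed.


Definition cf_of_mod : cf_obj f := CfObj img_incl_mono sec_defectE.

Definition glue (m : F_obj cf_of_mod) : X := t_sec m.1 + vsval m.2.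

Lemma t_glue (m0 : img_mod) (m1 : ker_mod) : t_act (t_sec m0 + vsval m1) = vsval m0.
Proof.
rewrite linearD /= t_secK; have /eqP -> : t_act (vsval m1) == 0.
  by rewrite -memv_ker subvsP.
by rewrite addr0.
Qed.

Lemma glueE m0 m1 : glue (m0, m1) = t_sec m0 + vsval m1.
Proof. by []. Qed.

Lemma glue_linear : linear glue.
Proof. by move=> c m n; rewrite /glue !linearP scalerDr addrACA. Qed.

HB.instance Definition _ :=
  GRing.isLinear.Build k (F_obj cf_of_mod) X *:%R glue glue_linear.

(** Since t (s(m0) + m1) = m0, the b-parts agree; the a-parts agree because f_M(a, m0) is exactly a
    s(m0) - s(a m0). *)
Lemma glue_hom (x : infdef f) m :
  linfun glue (act (F_obj cf_of_mod) x m) = act X x (linfun glue m).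
Proof.
have lin_glueE n : linfun glue n = glue n by rewrite lfunE.
rewrite !lin_glueE; case: x m => [a b] [m0 m1].
rewrite F_actE act_base !glueE t_glue !linearD /= !(val_sub_act ker_stable).
rewrite val_sec_defect val_img_incl base_actD.
by rewrite addrCA [t_sec _ + _]addrC subrK [LHS]addrC addrA.
Qed.

Definition unglue (x : X) : F_obj cf_of_mod :=
  let m0 : img_mod := vsproj (limg t_act) (t_act x) in
  (m0, vsproj (lker t_act) (x - t_sec m0)).

Lemma glueK : cancel glue unglue.
Proof.
by case=> m0 m1; rewrite /unglue glueE t_glue vsvalK [t_sec _ + _]addrC addrK vsvalK.
Qed.

(** As x - s(t x) lies in the kernel of t, both projections in [unglue] keep the values they are
    applied to. *)
Lemma unglueK : cancel unglue glue.
Proof.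
move=> x; rewrite /unglue; set m0 := vsproj _ _.
have m0E : vsval m0 = t_act x by rewrite vsprojK ?memv_img ?memvf.
have m1K : x - t_sec m0 \in lker t_act.
  by rewrite memv_ker linearB /= t_secK m0E subrr.
by rewrite glueE (vsprojK m1K) addrC subrK.
Qed.

Lemma F_ess_surj :
  exists M (e : modhom (F_obj M) X), @is_iso (fdmod_cat (infdef f)) _ _ e.
Proof.
exists cf_of_mod, (ModHom glue_hom); apply: (@bij_modhom_iso _ _ _ _ _ unglue).
  by move=> m; rewrite /= lfunE; apply: glueK.
by move=> x; rewrite /= lfunE; apply: unglueK.
Qed.

End EssSurj.

End Equivalence.

Theorem proposition3p1 (k : fieldType) (A : algebra k) (f : cocycle A) :
  is_equivalence (cf_functor f).
Proof.
apply: fully_faithful_ess_surj_equivalence.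
- exact: F_hom_faithful.
- exact: F_hom_full.
- exact: F_ess_surj.
Qed.
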